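(* Let $G$ be a connected $k$-regular simple graph with $k\geq 2$ and $|V(G)|\geq 4$, and let $n\geq 5$ be an integer. Then \[ \lambda_3(G\times K_n)=\begin{cases}\min\{n(n-1)\lambda_2(G),\,3k(n-1)-6\}, & \text{if } g(G)=3;\\ \min\{n(n-1)\lambda_2(G),\,3k(n-1)-4\}, & \text{if } g(G)\geq 4.\end{cases} \]
   Context: $K_n$ is the complete graph on $n$ vertices. The direct product $G\times H$ has vertex set $V(G)\times V(H)$, with $(u_1,v_1)$ adjacent to $(u_2,v_2)$ iff $u_1u_2\in E(G)$ and $v_1v_2\in E(H)$. For a graph $X$ and integer $j\ge 1$, an edge set $S\subseteq E(X)$ is a $j$-restricted edge-cut if $X-S$ is disconnected and every component of $X-S$ has at least $j$ vertices; $\lambda_j(X)$ is the minimum size of a $j$-restricted edge-cut, or $+\infty$ if none exists. $g(G)$ denotes the girth of $G$ (length of a shortest cycle). *)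

(* Defs.v *)
From HB Require Import structures.
From mathcomp Require Import all_boot all_order all_algebra.
From mathcomp Require Import constructive_ereal.
Set Implicit Arguments.
Unset Strict Implicit.
Unset Printing Implicit Defensive.
Import Order.TTheory GRing.Theory Num.Theory.

Record sgraph := SGraph {
  vertex :> finType;
  adj : rel vertex;
  adj_sym : symmetric adj;
  adj_irrefl : irreflexive adj
}.

Definition edges (G : sgraph) : {set {set G}} :=
  [set [set p.1; p.2] | p : G * G & adj p.1 p.2].

Definition neighbors (G : sgraph) (x : G) : {set G} := [set y | adj x y].

Definition regular (k : nat) (G : sgraph) : Prop :=
  forall x : G, #|neighbors x| = k.

Definition connected (G : sgraph) : bool :=
  [forall x : G, forall y : G, connect (@adj G) x y].

Definition components (G : sgraph) : {set {set G}} :=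
  equivalence_partition (connect (@adj G)) [set: G].

Definition complete_adj (n : nat) : rel 'I_n := fun i j => i != j.

Fact complete_sym (n : nat) : symmetric (@complete_adj n).
Proof. by move=> i j; rewrite /complete_adj eq_sym. Qed.

Fact complete_irrefl (n : nat) : irreflexive (@complete_adj n).
Proof. by move=> i; rewrite /complete_adj eqxx. Qed.

Definition complete (n : nat) : sgraph :=
  SGraph (@complete_sym n) (@complete_irrefl n).

Definition direct_adj (G H : sgraph) : rel (G * H) :=
  fun p q => adj p.1 q.1 && adj p.2 q.2.

Fact direct_sym (G H : sgraph) : symmetric (@direct_adj G H).
Proof. by move=> p q; rewrite /direct_adj adj_sym (adj_sym p.2). Qed.

Fact direct_irrefl (G H : sgraph) : irreflexive (@direct_adj G H).
Proof. by move=> p; rewrite /direct_adj adj_irrefl. Qed.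

Definition direct_product (G H : sgraph) : sgraph :=
  SGraph (@direct_sym G H) (@direct_irrefl G H).

Definition delete_adj (G : sgraph) (S : {set {set G}}) : rel G :=
  fun x y => adj x y && ([set x; y] \notin S).

Fact delete_sym (G : sgraph) (S : {set {set G}}) : symmetric (delete_adj S).
Proof. by move=> x y; rewrite /delete_adj adj_sym setUC. Qed.

Fact delete_irrefl (G : sgraph) (S : {set {set G}}) :
  irreflexive (delete_adj S).
Proof. by move=> x; rewrite /delete_adj adj_irrefl. Qed.

Definition delete_edges (G : sgraph) (S : {set {set G}}) : sgraph :=
  SGraph (delete_sym S) (delete_irrefl S).

Definition restricted_edge_cut (j : nat) (X : sgraph) (S : {set {set X}}) : bool :=
  [&& S \subset edges X,
      ~~ connected (delete_edges S)
    & [forall C in components (delete_edges S), j <= #|C|]].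

(* The value is +oo when there is no j-restricted edge-cut. *)
Definition restricted_edge_connectivity (j : nat) (X : sgraph) : \bar int :=
  \big[mine/+oo%E]_(S : {set {set X}} | restricted_edge_cut j S) (#|S|%:Z)%:E.

(* Some cycle of G runs through exactly l distinct vertices; l > 2 rules out
   the closed walks x, y, x along a single edge. *)
Definition has_cycle (G : sgraph) (l : nat) : bool :=
  (2 < l) && [exists c : l.-tuple G, ucycleb (@adj G) c].

(* A cycle has at most #|G| vertices, so bounding l loses nothing; the girth
   of an acyclic graph is +oo. *)
Definition girth (G : sgraph) : \bar int :=
  \big[mine/+oo%E]_(l < #|G|.+1 | has_cycle G l) (l%:Z)%:E.

(* Main.v *)
(* Write a_u for the size of the fibre over u in G of a vertex set A of G x K_n.
   The edges joining the fibres over adjacent u and v form a crown graph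
   (K_{n,n} minus a perfect matching); A cuts at least (n-1)|a_u - a_v| of them,
   and at least 2n-4 if neither fibre is empty or full.
   If A has both a full and an empty fibre, then by the coarea formula A cuts at
   least n(n-1) times the smallest edge cut of G, and an edge cut of G that is
   not 2-restricted has at least k edges, where n(n-1)k >= 3k(n-1).
   Otherwise, up to complementing A, no fibre is full. Let M be the set of the s
   vertices with a nonempty fibre and E the number of ordered adjacent pairs in
   M. Then A cuts at least (n-1)(ks - E) + (n-2)E = (n-1)ks - E edges, and the
   values 6 and 4 are the largest possible E for s = 3, with and without
   triangles. For s >= 4 the bound E <= ks suffices since n >= 5, for s = 2
   the vertices are counted with their weights a_u, and s = 1 would leave A
   without edges. *)
Require Import Defs.
From HB Require Import structures.
From mathcomp Require Import all_boot all_order all_algebra.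
From mathcomp Require Import constructive_ereal zify.
Import Order.TTheory GRing.Theory Num.Theory.

Set Implicit Arguments.
Unset Strict Implicit.
Unset Printing Implicit Defensive.

(** * Edge counts, boundaries and restricted cuts in a single graph *)

Section EdgeCounts.
Variable G : sgraph.
Implicit Types (A B M : {set G}) (x y : G) (S : {set {set G}}).

Definition degree_in A x := \sum_(y in A) (adj x y : nat).
(** Ordered pairs: every edge inside [A] counts twice. *)
Definition inner_pairs A := \sum_(x in A) degree_in A x.
Definition cut_size A := \sum_(x in A) degree_in (~: A) x.
Definition boundary A : {set {set G}} :=
  [set [set p.1; p.2] | p : G * G & [&& adj p.1 p.2, p.1 \in A & p.2 \notin A]].

Lemma degree_inE A x : degree_in A x = #|[set y in A | adj x y]|.
Proof.
rewrite /degree_in -big_mkcondr /= -sum1_card.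
by apply: eq_bigl => y; rewrite !inE.
Qed.

Lemma degree_in_setT k x : regular k G -> degree_in setT x = k.
Proof.
move=> /(_ x) <-; rewrite degree_inE; apply: eq_card => y.
by rewrite !inE.
Qed.

Lemma degree_inC k A x :
  regular k G -> degree_in A x + degree_in (~: A) x = k.
Proof.
move=> /(degree_in_setT x) <-; rewrite /degree_in [RHS](bigID (mem A)) /=.
by congr (_ + _); apply: eq_bigl => y; rewrite !inE.
Qed.

Lemma degree_in_lt_card A x : x \in A -> degree_in A x < #|A|.
Proof.
move=> xA; rewrite degree_inE; apply/proper_card/properP; split.
  by apply/subsetP => y; rewrite inE => /andP[].
by exists x; rewrite // !inE adj_irrefl andbF.
Qed.

Lemma cut_inner k A :
  regular k G -> cut_size A + inner_pairs A = k * #|A|.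
Proof.
move=> Greg; rewrite /cut_size /inner_pairs -big_split /= mulnC -sum_nat_const.
by apply: eq_bigr => x _; rewrite addnC (degree_inC _ _ Greg).
Qed.

Lemma cut_sizeC A : cut_size (~: A) = cut_size A.
Proof.
rewrite /cut_size /degree_in setCK exchange_big /=.
by apply: eq_bigr => x _; apply: eq_bigr => y _; rewrite adj_sym.
Qed.

(** Each cut edge is seen from both ends. Sums over all ordered pairs can later be exchanged and
    compared termwise. *)
Lemma cut_size_double A :
  (cut_size A).*2 = \sum_x \sum_y adj x y * ((x \in A) (+) (y \in A)).
Proof.
rewrite -addnn -{2}cut_sizeC [RHS](bigID (mem A)) /=.
congr (_ + _).
  apply: eq_bigr => x xA; rewrite /degree_in [RHS](bigID (mem A)) /= xA.
  rewrite [X in _ = X + _]big1 => [|y ->]; last by rewrite muln0.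
  rewrite add0n; apply: eq_big => [y|y]; first by rewrite inE.
  by rewrite inE => /negPf ->; rewrite muln1.
apply: eq_big => [x|x]; first by rewrite inE.
rewrite inE => /negPf xA.
rewrite /degree_in setCK [RHS](bigID (mem A)) /= xA.
rewrite [X in _ = _ + X]big1 => [|y /negPf ->]; last by rewrite muln0.
by rewrite addn0; apply: eq_bigr => y ->; rewrite muln1.
Qed.

Lemma card_boundary A : #|boundary A| = cut_size A.
Proof.
rewrite card_in_imset.
  rewrite -sum1_card /cut_size /degree_in.
  rewrite pair_big_dep /= [RHS](bigID (fun p => adj p.1 p.2)) /= addnC.
  rewrite [X in _ = X + _]big1 => [|p /andP[_ /negPf ->]] //.
  rewrite add0n; apply: eq_big => p; last by rewrite inE => /and3P[->].
  by rewrite !inE andbC.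
move=> [x y] [x' y']; rewrite !inE /= => /and3P[_ xA yA] /and3P[_ x'A y'A] E.
have : x \in [set x'; y'] by rewrite -E set21.
have : y \in [set x'; y'] by rewrite -E set22.
rewrite !inE => /orP[]/eqP yE /orP[]/eqP xE; subst => //.
- by rewrite x'A in yA.
- by rewrite x'A in yA.
- by rewrite xA in y'A.
Qed.

Lemma boundary_sub_edges A : boundary A \subset edges G.
Proof.
apply/subsetP => e /imsetP[p]; rewrite inE => /and3P[ap _ _] ->.
by apply/imsetP; exists p; rewrite // inE.
Qed.

Lemma mem_boundary A x y :
  adj x y -> ([set x; y] \in boundary A) = (x \in A) (+) (y \in A).
Proof.
move=> axy; apply/imsetP/idP => [[[u v]]|].
  rewrite inE /= => /and3P[auv uA vA] E.
  have : x \in [set u; v] by rewrite -E set21.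
  have : y \in [set u; v] by rewrite -E set22.
  rewrite !inE => /orP[]/eqP yE /orP[]/eqP xE; subst.
  - by rewrite adj_irrefl in axy.
  - by rewrite uA (negPf vA).
  - by rewrite uA (negPf vA).
  - by rewrite adj_irrefl in axy.
case xA: (x \in A); case yA: (y \in A) => // _.
  by exists (x, y); rewrite // inE /= axy xA yA.
by exists (y, x); rewrite ?inE /= ?(adj_sym y) ?axy ?xA ?yA // setUC.
Qed.

Lemma delete_boundary A x y :
  delete_adj (boundary A) x y = adj x y && ((x \in A) == (y \in A)).
Proof.
rewrite /delete_adj; case axy: (adj x y) => //=.
by rewrite mem_boundary //; case: (x \in A); case: (y \in A).
Qed.

Lemma mem_components S C :
  C \in components (delete_edges S) ->
  exists x, C = [set y | connect (delete_adj S) x y].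
Proof.
move=> /imsetP[x _ ->]; exists x; apply/setP => y; by rewrite !inE.
Qed.

Lemma component_mem S x :
  [set y | connect (delete_adj S) x y] \in components (delete_edges S).
Proof. by apply/imsetP; exists x => //; apply/setP => y; rewrite !inE. Qed.

(** Components need not be computed: at least [j] vertices reachable from [x] already bound its
    component from below. *)
Lemma boundary_restricted j A :
  A != set0 -> ~: A != set0 ->
  (forall x, exists2 C : {set G}, j <= #|C| &
     forall y, y \in C -> connect (delete_adj (boundary A)) x y) ->
  restricted_edge_cut j (boundary A).
Proof.
move=> /set0Pn[a aA] /set0Pn[b bA] comp_ge; apply/and3P; split.
- exact: boundary_sub_edges.
- apply/negP => /forallP/(_ a)/forallP/(_ b) /= cab.
  have clA : closed (delete_adj (boundary A)) (mem A).
    by move=> x y; rewrite delete_boundary => /andP[_ /eqP].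
  have := closed_connect clA cab; rewrite aA.
  by move: bA; rewrite inE => /negPf ->.
apply/forall_inP => C /mem_components[x ->].
have [D jD Dx] := comp_ge x.
apply: leq_trans jD _; apply/subset_leq_card/subsetP => y /Dx.
by rewrite inE.
Qed.

(** Deleting [boundary A] leaves no isolated vertex. *)
Definition same_side_neighbors A :=
  forall x, exists2 y, adj x y & (x \in A) = (y \in A).

Lemma same_side_neighborsC A :
  same_side_neighbors A -> same_side_neighbors (~: A).
Proof. by move=> sA x; have [y axy xy] := sA x; exists y; rewrite // !inE xy. Qed.

(** Take for [A] one component left by deleting [S]: all edges leaving it lie in [S], and its
    complement contains another component. *)
Lemma restricted_cut_side j S :
  1 < j -> restricted_edge_cut j S ->
  exists A, [/\ j <= #|A|, j <= #|~: A|, same_side_neighbors A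
             & cut_size A <= #|S|].
Proof.
move=> j_gt1 /and3P[_ + /forall_inP comp_ge].
have csym : connect_sym (delete_adj S).
  by apply: sym_connect_sym; apply: delete_sym.
rewrite negb_forall => /existsP[a]; rewrite negb_forall => /existsP[b nab].
pose A := [set y | connect (delete_adj S) a y]; exists A; split.
- exact/comp_ge/component_mem.
- have := comp_ge _ (component_mem S b); move/leq_trans; apply.
  apply/subset_leq_card/subsetP => y; rewrite !inE => cby.
  apply: contra nab => cay; apply: connect_trans cay _.
  by rewrite csym.
- move=> x; have := comp_ge _ (component_mem S x).
  (* The component of [x] has a second vertex [t]; the first edge of a path to [t] gives the
     neighbour. *)
  move=> /(leq_trans j_gt1)/card_gt1P[y [z []]]; rewrite !inE => cy cz yz.
  have [t /connectP[[|u p] //= + tE] tx] :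
      exists2 t, connect (delete_adj S) x t & t != x.
    by case: (eqVneq y x) => [yx|]; [exists z; rewrite // -yx eq_sym|exists y].
    by rewrite tE eqxx in tx.
  move=> /andP[dxu _]; exists u; first by case/andP: dxu.
  by rewrite !inE; apply: (same_connect_r csym); apply: connect1.
- rewrite -card_boundary; apply/subset_leq_card/subsetP => e /imsetP[[x y]].
  rewrite !inE /= => /and3P[axy cax cay] ->; apply: contraR cay => nS.
  by apply: connect_trans cax _; apply: connect1; rewrite /delete_adj axy.
Qed.

Lemma same_side_restricted A :
  A != set0 -> ~: A != set0 -> same_side_neighbors A ->
  restricted_edge_cut 2 (boundary A).
Proof.
move=> A0 cA0 sA; apply: boundary_restricted => // x.
have [y axy xy] := sA x; exists [set x; y].
  by rewrite cards2; case: eqVneq axy => // ->; rewrite adj_irrefl.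
move=> z; rewrite !inE => /orP[]/eqP ->; first exact: connect0.
by apply: connect1; rewrite delete_boundary axy xy eqxx.
Qed.

(* A vertex with no neighbour on its own side sends all its k edges across. *)
Lemma cut_size_ge_degree k A :
  regular k G -> same_side_neighbors A \/ k <= cut_size A.
Proof.
move=> Greg.
case: (pickP (fun x => [forall y, adj x y ==> ((x \in A) != (y \in A))])).
  move=> x /forallP xP; right.
  have step B : x \in B ->
      (forall y, adj x y -> y \notin B) -> k <= cut_size B.
    move=> xB nB; rewrite /cut_size (bigD1 x) //=.
    rewrite -(degree_inC B x Greg) [degree_in B x]big1 ?add0n ?leq_addr //.
    by move=> y yB; case axy: (adj x y) => //; have := nB _ axy; rewrite yB.
  case xA: (x \in A).
    by apply: step => // y axy; have := xP y; rewrite axy xA; case: (y \in A).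
  rewrite -cut_sizeC; apply: step; first by rewrite inE xA.
  by move=> y axy; have := xP y; rewrite axy xA inE; case: (y \in A).
move=> nx; left=> x; have /negbT/forallPn[y] := nx x.
by rewrite negb_imply negbK => /andP[axy /eqP xy]; exists y.
Qed.

Lemma inner_pairs3 x y z : x != y -> y != z -> z != x ->
  inner_pairs [set x; y; z] = (adj x y + adj y z + adj z x).*2.
Proof.
move=> xy yz zx; have nz : z \notin [set x; y].
  by rewrite !inE negb_or zx eq_sym yz.
have E (F : G -> nat) : \sum_(t in [set x; y; z]) F t = F z + (F x + F y).
  by rewrite setUC big_setU1 //= big_setU1 ?inE // big_set1.
rewrite /inner_pairs /degree_in !E !adj_irrefl.
rewrite (adj_sym x z) (adj_sym y x) (adj_sym z y); lia.
Qed.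

Lemma card3P A : #|A| = 3 ->
  exists x y z, [/\ x != y, y != z, z != x & A = [set x; y; z]].
Proof.
move=> A3; have /card_gt2P[x [y [z [[xA yA zA] [xy yz zx]]]]] : 2 < #|A| by lia.
exists x, y, z; split=> //; apply/eqP; rewrite eq_sym eqEcard A3.
apply/andP; split.
  by apply/subsetP => t; rewrite !inE => /orP[/orP[]|] /eqP ->.
rewrite setUC cardsU1 cards2 xy !inE negb_or zx; by rewrite eq_sym yz.
Qed.

Lemma inner_pairs3_le6 A : #|A| = 3 -> inner_pairs A <= 6.
Proof.
move=> /card3P[x [y [z [xy yz zx ->]]]]; rewrite inner_pairs3 //; lia.
Qed.

Lemma inner_pairs3_le4 A :
  (forall x y z, ~~ [&& adj x y, adj y z & adj z x]) ->
  #|A| = 3 -> inner_pairs A <= 4.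
Proof.
move=> notri /card3P[x [y [z [xy yz zx ->]]]]; rewrite inner_pairs3 //.
have := notri x y z; lia.
Qed.

(** Irreflexivity makes three pairwise adjacent vertices distinct. *)
Lemma has_cycle3P : reflect
  (exists x y z, [&& adj x y, adj y z & adj z x]) (has_cycle G 3).
Proof.
rewrite /has_cycle ltnSn /=; apply: (iffP existsP).
  move=> [[[|x [|y [|z [|t c]]]] //= _]].
  by rewrite /ucycleb /= andbT => /andP[xyz _]; exists x, y, z.
move=> [x [y [z xyz]]]; exists [tuple x; y; z].
rewrite /ucycleb /= !inE andbT xyz /=.
case/and3P: xyz => xy yz zx; rewrite negb_or !andbT -andbA.
by apply/and3P; split; apply/eqP => E; subst; rewrite ?adj_irrefl in xy yz zx.
Qed.

End EdgeCounts.
(** * Cuts of the crown graph *)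

Section Crown.
Variable n : nat.
Implicit Types P Q : {set 'I_n}.
(** [P] and [Q] are the chosen parts of the two sides of the crown graph. *)
Definition crown_cut P Q :=
  \sum_i \sum_j complete_adj i j * ((i \in P) (+) (j \in Q)).

(** The right side is the cut in the full bipartite graph; the removed matching loses one cut edge
    for each index in exactly one of [P] and [Q]. *)
Lemma crown_cut_eq P Q :
  crown_cut P Q + #|P :\: Q| + #|Q :\: P| =
  #|P| * (n - #|Q|) + (n - #|P|) * #|Q|.
Proof.
have cC (R : {set 'I_n}) : n - #|R| = #|~: R|.
  by rewrite [in RHS]cardsCs setCK card_ord.
have E (R T : {set 'I_n}) : #|R| * #|T| = \sum_i \sum_j (i \in R) * (j \in T).
  rewrite -[#|R|]sum1_card -[#|T|]sum1_card big_mkcond big_distrl /=.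
  apply: eq_bigr => i _; rewrite big_mkcond /= big_distrr /=.
  by apply: eq_bigr => j _; case: (i \in R); case: (j \in T).
have D (R T : {set 'I_n}) :
    #|R :\: T| = \sum_i \sum_j (i == j) * ((i \in R) && (j \notin T)).
  rewrite -sum1_card big_mkcond /=; apply: eq_bigr => i _.
  rewrite (bigD1 i) //= eqxx mul1n big1 ?addn0.
    by rewrite inE andbC; case: (_ && _).
  by move=> j; rewrite eq_sym => /negPf ->.
rewrite !cC !E /crown_cut !D -!big_split /=; apply: eq_bigr => i _.
rewrite -!big_split /=; apply: eq_bigr => j _.
rewrite !inE /complete_adj; case: eqVneq => [->|_].
  by case: (j \in P); case: (j \in Q).
by case: (i \in P); case: (j \in Q).
Qed.

(** The sizes of the four cells of the Venn diagram of [P] and [Q] reduce both bounds below to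
    arithmetic. *)
Lemma crown_cut_cells P Q : exists r x y z,
  [/\ #|P| = r + x, #|Q| = r + y, n = r + x + y + z
    & crown_cut P Q + x + y = (r + x) * (x + z) + (y + z) * (r + y)].
Proof.
exists #|P :&: Q|, #|P :\: Q|, #|Q :\: P|, #|~: (P :|: Q)|.
have p := cardsID Q P; have q := cardsID P Q; rewrite setIC in q.
have u := cardsUI P Q; have c := cardsC (P :|: Q); rewrite card_ord in c.
have e := crown_cut_eq P Q.
by split; try lia; rewrite e -p -q; congr (_ * _ + _ * _); lia.
Qed.

(** Subtraction is truncated, so the two terms add up to [n - 1] times the absolute difference. *)
Lemma crown_cut_ge_diff P Q :
  (n - 1) * (#|P| - #|Q|) + (n - 1) * (#|Q| - #|P|) <= crown_cut P Q.
Proof.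
have [r [x [y [z [-> -> nE e]]]]] := crown_cut_cells P Q.
move: (crown_cut P Q) e => c e.
case: (posnP n) => [->|n0]; first by rewrite !mul0n.
case: (leqP x y) => xy.
  have [d dE] : exists d, y = x + d by exists (y - x); lia.
  have -> : r + x - (r + y) = 0 by lia.
  have -> : r + y - (r + x) = d by lia.
  have [m mE] : exists m, n = m + 1 by exists (n - 1); lia.
  have -> : n - 1 = m by lia.
  have {}mE : m + 1 = r + x + (x + d) + z by lia.
  have : m * d + d = (r + x + (x + d) + z) * d by rewrite -mE; lia.
  (* The cut exceeds [(n - 1) * d] by [2(r + x)(x + z) - 2x], and the product is at least
     [x * x]. *)
  have : x <= x * x by nia.
  rewrite {}dE in e; lia.
have [d dE] : exists d, x = y + d by exists (x - y); lia.
have -> : r + y - (r + x) = 0 by lia.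
have -> : r + x - (r + y) = d by lia.
have [m mE] : exists m, n = m + 1 by exists (n - 1); lia.
have -> : n - 1 = m by lia.
have {}mE : m + 1 = r + y + d + y + z by lia.
have : m * d + d = (r + y + d + y + z) * d by rewrite -mE; lia.
have : y <= y * y by nia.
rewrite {}dE in e; lia.
Qed.

(** Two distinct singletons attain the bound. The proof splits on whether [r] and [z] vanish. *)
Lemma crown_cut_ge_mixed P Q :
  0 < #|P| < n -> 0 < #|Q| < n -> 2 * n - 4 <= crown_cut P Q.
Proof.
have [r [x [y [z [-> -> nE e]]]]] := crown_cut_cells P Q.
move: (crown_cut P Q) e => c e /andP[h1 h2] /andP[h3 h4].
rewrite nE.
have {h1 h2 h3 h4} [h1 h2 h3 h4] :
  [/\ 0 < r + x, 0 < r + y, 0 < x + z & 0 < y + z] by split; lia.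
case: r nE e h1 h2 => [|r]; case: z h3 h4 => [|z] h3 h4 nE e h1 h2.
- have [a xE] : exists a, x = a.+1 by exists x.-1; lia.
  have [b yE] : exists b, y = b.+1 by exists y.-1; lia.
  (* With [r = z = 0] the excess over [2n - 4] is [a(a - 1) + b(b - 1)]. *)
  subst x y. have : a <= a * a by nia.
  have : b <= b * b by nia. lia.
- have [a xE] : exists a, x = a.+1 by exists x.-1; lia.
  have [b yE] : exists b, y = b.+1 by exists y.-1; lia.
  subst x y. nia.
- have [a xE] : exists a, x = a.+1 by exists x.-1; lia.
  have [b yE] : exists b, y = b.+1 by exists y.-1; lia.
  subst x y. nia.
- have : x <= x * x by nia.
  have : y <= y * y by nia.
  have := leq0n (r * z); nia.
Qed.
End Crown.

(** * Level sets and the discrete coarea formula *)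

Lemma sum_levels n a b : a <= n -> b <= n ->
  \sum_(t < n) ((t < a) (+) (t < b)) = (a - b) + (b - a).
Proof.
move=> an bn.
(* Capping both values at [n] gives an identity free of the bounds, which induction on [n] can
   prove. *)
have -> : (a - b) + (b - a) = (minn a n - minn b n) + (minn b n - minn a n).
  by lia.
elim: n {an bn} => [|n IHn]; first by rewrite big_ord0; lia.
rewrite big_ord_recr /= IHn.
case: (ltnP n a) => na; case: (ltnP n b) => nb /=; lia.
Qed.

(** Coarea formula: the difference of [f] along an edge counts the thresholds [t] whose level set
    cuts that edge. *)
Lemma sum_adj_levels (G : sgraph) n (f : G -> nat) : (forall u, f u <= n) ->
  \sum_u \sum_v adj u v * ((f u - f v) + (f v - f u)) =
  \sum_(t < n) (cut_size [set u | t < f u]).*2.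
Proof.
move=> fn; rewrite [RHS](eq_bigr _ (fun t _ => cut_size_double _)).
rewrite [RHS]exchange_big /=; apply: eq_bigr => u _.
rewrite [RHS]exchange_big /=; apply: eq_bigr => v _.
rewrite -(@sum_levels n) // big_distrr /=.
by apply: eq_bigr => t _; rewrite !inE.
Qed.

(** * Cuts of the direct product with a complete graph *)

Section Product.
Variables (G : sgraph) (k n : nat).
Hypothesis Greg : regular k G.
Local Notation X := (direct_product G (complete n)).
Implicit Types (A : {set X}) (u v : G).

Lemma regular_product : regular (k * (n - 1)) X.
Proof.
move=> [u i]; have -> : n - 1 = #|[set~ i]| by rewrite cardsC1 card_ord subn1.
rewrite -(Greg u) -cardsX.
by apply: eq_card => -[v j]; rewrite !inE /= /direct_adj /= /complete_adj eq_sym.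
Qed.

Definition fibre A u : {set 'I_n} := [set i | (u, i) \in A].

Lemma card_fibre_le A u : #|fibre A u| <= n.
Proof. by rewrite -[leqRHS]card_ord max_card. Qed.

Lemma card_fibreC A u : #|fibre (~: A) u| = n - #|fibre A u|.
Proof.
have := cardsC (fibre A u); rewrite card_ord.
have -> : ~: fibre A u = fibre (~: A) u by apply/setP => i; rewrite !inE.
lia.
Qed.

Lemma card_fibres A : \sum_u #|fibre A u| = #|A|.
Proof.
rewrite -[RHS]sum1_card [RHS]big_mkcond /=.
rewrite [RHS](eq_bigr (fun p => if (p.1, p.2) \in A then 1 else 0)); last by case.
rewrite -(pair_bigA _ (fun u i => if (u, i) \in A then 1 else 0)) /=.
apply: eq_bigr => u _; rewrite -big_mkcond /= sum1_card.
by apply: eq_card => i; rewrite inE.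
Qed.

(** Product edges are grouped by the ordered pair of fibres that they join, one crown graph per
    adjacent pair. *)
Lemma cut_product A : (cut_size A).*2 =
  \sum_u \sum_v adj u v * crown_cut (fibre A u) (fibre A v).
Proof.
pose F (p q : X) := adj p q * ((p \in A) (+) (q \in A)).
rewrite cut_size_double.
rewrite (eq_bigr (fun p => \sum_q F (p.1, p.2) q)); last by case.
rewrite -(pair_bigA _ (fun u i => \sum_q F (u, i) q)) /=.
apply: eq_bigr => u _.
under eq_bigr => i _.
  rewrite (eq_bigr (fun q => F (u, i) (q.1, q.2))); last by case.
  rewrite -(pair_bigA _ (fun v j => F (u, i) (v, j))) /=.
  over.
rewrite exchange_big /=; apply: eq_bigr => v _.
rewrite /crown_cut big_distrr /=; apply: eq_bigr => i _.
rewrite big_distrr /=; apply: eq_bigr => j _.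
by rewrite /F /= /direct_adj /= !inE; case: (adj u v); rewrite ?mul1n.
Qed.

(* Coarea: the cut dominates n - 1 times the total variation of the fibre
   sizes, which equals the sum of the cuts of the level sets. *)
Lemma cut_ge_levels A u v m : 0 < n ->
  (forall B : {set G}, B != set0 -> ~: B != set0 -> m <= cut_size B) ->
  #|fibre A u| = n -> #|fibre A v| = 0 -> n * (n - 1) * m <= cut_size A.
Proof.
move=> n0 mle fu fv; rewrite -leq_double cut_product.
pose f w := #|fibre A w|.
apply: (@leq_trans ((n - 1) * \sum_(t < n) (cut_size [set w | t < f w]).*2)).
  have -> : (n * (n - 1) * m).*2 = (n - 1) * (n * m.*2) by lia.
  rewrite leq_mul2l; apply/orP; right.
  rewrite -{1}[n]card_ord -sum_nat_const.
  (* Every level set contains [u] and misses [v], hence is a proper cut of [G]. *)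
  apply: leq_sum => t _; rewrite leq_double; apply: mle; apply/set0Pn.
    by exists u; rewrite inE /f fu.
  by exists v; rewrite !inE /f fv.
rewrite -sum_adj_levels => [|w]; last exact: card_fibre_le.
rewrite big_distrr /=; apply: leq_sum => w _.
rewrite big_distrr /=; apply: leq_sum => z _.
case: (adj w z); rewrite ?mul0n ?muln0 // !mul1n mulnDr.
exact: crown_cut_ge_diff.
Qed.

Definition fibre_support A := [set u | 0 < #|fibre A u|].

Lemma mem_support A u i : (u, i) \in A -> u \in fibre_support A.
Proof.
by move=> uiA; rewrite inE card_gt0; apply/set0Pn; exists i; rewrite inE. Qed.

Lemma card_support A : \sum_(u in fibre_support A) #|fibre A u| = #|A|.
Proof.
rewrite -card_fibres [RHS](bigID (mem (fibre_support A))) /= [X in _ + X]big1 ?addn0 //.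
by move=> u; rewrite inE -eqn0Ngt => /eqP.
Qed.

(** An edge of [G] leaving the support meets an empty fibre, so the difference bound applies; an
    edge inside joins two mixed fibres and gives [2n - 4], that is [n - 2] per ordered pair. *)
Lemma cut_ge_support A : (forall u, #|fibre A u| < n) ->
  (n - 1) * \sum_(u in fibre_support A) #|fibre A u| * degree_in (~: fibre_support A) u
    + (n - 2) * inner_pairs (fibre_support A) <= cut_size A.
Proof.
move=> fn; rewrite -leq_double cut_product; set M := fibre_support A.
pose f w := #|fibre A w|.
pose a u v := (u \in M) * (v \notin M) * (adj u v * f u).
have aE : \sum_u \sum_v a u v = \sum_(u in M) f u * degree_in (~: M) u.
  rewrite [RHS]big_mkcond /=; apply: eq_bigr => u _.
  rewrite /a; case: (u \in M); last by rewrite big1.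
  rewrite /degree_in [in RHS]big_mkcond big_distrr /=.
  by apply: eq_bigr => v _; rewrite in_setC; case: (v \in M);
    rewrite /= ?muln0 ?mul1n // mulnC.
have eE : \sum_u \sum_v (u \in M) * (v \in M) * adj u v = inner_pairs M.
  rewrite /inner_pairs [RHS]big_mkcond /=; apply: eq_bigr => u _.
  case: (u \in M); last by rewrite big1.
  rewrite /degree_in [in RHS]big_mkcond /=.
  by apply: eq_bigr => v _; case: (v \in M); rewrite /= ?mul1n.
rewrite -/f -aE -eE.
(* The doubled sum meets each edge leaving the support in both orders: [a] enters once as it is and
   once transposed. *)
have -> : forall s t, ((n - 1) * s + (n - 2) * t).*2 =
  (n - 1) * s + ((n - 1) * s + (2 * n - 4) * t) by move=> s t; lia.
rewrite {2}exchange_big !big_distrr /= -!big_split /=; apply: leq_sum => u _.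
rewrite !big_distrr /= -!big_split /=; apply: leq_sum => v _.
rewrite /a adj_sym; case: (adj v u); rewrite ?muln0 // !mul1n.
have := crown_cut_ge_diff (fibre A u) (fibre A v).
have := @crown_cut_ge_mixed _ (fibre A u) (fibre A v).
rewrite !fn !andbT -/(f u) -/(f v).
have fM w : (w \in M) = (0 < f w) by rewrite inE.
rewrite !fM; case: (posnP (f u)) => fu; case: (posnP (f v)) => fv mixed diff /=.
- lia.
- by rewrite fu in diff; lia.
- by rewrite fv in diff; lia.
- by have := mixed isT isT; lia.
Qed.

(** Here [e] stands for 6 or 4. [eG] serves a support of three vertices, [eX] a set [A] of three
    vertices; the adjacent pair in [A] excludes a support of one vertex. *)
Lemma cut_ge_no_full A e : 2 <= k -> 5 <= n -> 4 <= e ->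
  (forall B : {set G}, #|B| = 3 -> inner_pairs B <= e) ->
  (forall B : {set X}, #|B| = 3 -> inner_pairs B <= e) ->
  2 < #|A| -> (exists p q, [/\ adj p q, p \in A & q \in A]) ->
  (forall u, #|fibre A u| < n) -> 3 * k * (n - 1) <= cut_size A + e.
Proof.
move=> k2 n5 e4 eG eX A3 [[u i] [[v j] [/andP[/= uv _] uA vA]]] fn.
have {uA} uM := mem_support uA; have {vA} vM := mem_support vA.
have := cut_ge_support fn; set M := fibre_support A in uM vM *.
set S := \sum_(w in M) _; set E := inner_pairs M => cutA.
have uvM : u != v by apply: contraTneq uv => ->; rewrite adj_irrefl.
have M2 : 1 < #|M| by apply/card_gt1P; exists u, v.
have EE : \sum_(w in M) degree_in (~: M) w + E = k * #|M| := cut_inner M Greg.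
case: (ltngtP #|M| 2) => [|M_gt2|{}M2]; first by lia.
  (* Support of at least three vertices: nonempty fibres have weight at least 1, which leaves the
     bound [(n - 1)k|M| - E]. *)
  have SE : \sum_(w in M) degree_in (~: M) w <= S.
    by apply: leq_sum => w; rewrite inE => ?; rewrite leq_pmull.
  move: EE SE; set T := \sum_(w in M) _ => EE SE.
  have [m mE] : exists m, n = m + 2 by exists (n - 2); lia.
  have [n1 n2] : n - 1 = m + 1 /\ n - 2 = m by lia.
  rewrite n1 n2 in cutA *.
  have cutE : (m + 1) * (k * #|M|) <= cut_size A + E.
    rewrite -EE; apply: leq_trans (_ : (m + 1) * S + m * E + E <= _); last by lia.
    by have := leq_mul (leqnn (m + 1)) SE; lia.
  case: (ltngtP #|M| 3) => [|M_gt3|M3]; first by lia.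
    (* The bound is now at least [4(n - 2)k], and [4(n - 2) >= 3(n - 1)] exactly when [n >= 5]. *)
    have : E <= k * #|M| by lia.
    have : 4 * (m * k) <= #|M| * (m * k) by rewrite leq_mul2r M_gt3 orbT.
    have : k * 3 <= k * m by rewrite leq_mul2l; lia.
    lia.
  by have := eG _ M3; rewrite M3 in cutE; rewrite -/E; lia.
(* Support of two vertices: each has at least [k - 1] neighbours outside. With [|A| >= 4] and
   [E >= 2] the cut is at least [4(k - 1)(n - 1) + 2(n - 2)], enough since [k >= 2] and [e >= 4]. *)
case: (ltngtP #|A| 3) => [|A_gt3|{}A3]; first by lia.
  have SE : (k - 1) * #|A| <= S.
    rewrite -card_support big_distrr /=; apply: leq_sum => w wM.
    rewrite mulnC leq_mul2l; apply/orP; right.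
    by have := degree_inC M w Greg; have := degree_in_lt_card wM; rewrite -/M; lia.
  have E2 : 2 <= E.
    rewrite /E /inner_pairs (bigD1 u) //= (bigD1 v) /=; last by rewrite vM eq_sym.
    have deg_gt0 x y : adj x y -> y \in M -> 0 < degree_in M x.
      by move=> xy yM; rewrite /degree_in (bigD1 y) //= xy.
    have := deg_gt0 _ _ uv vM; rewrite adj_sym in uv.
    by have := deg_gt0 _ _ uv uM; lia.
  have : (k - 1) * 4 <= S by apply: leq_trans SE; rewrite leq_mul2l A_gt3 orbT.
  nia.
(* For [|A| = 3] the edges are counted directly in the regular product. *)
have := cut_inner A regular_product; have := eX _ A3.
by rewrite A3; lia.
Qed.
End Product.

(** * Restricted edge-cuts *)

Section RestrictedCuts.
Variable X : sgraph.
Implicit Types (A : {set X}) (p q r x y z : X).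

(** Every vertex lies on a path of three vertices within its own side. *)
Lemma same_side_restricted3 A : A != set0 -> ~: A != set0 ->
  (forall x, exists y z, [/\ adj x y, z != x, z != y, adj x z || adj y z
     & (x \in A) = (y \in A) /\ (x \in A) = (z \in A)]) ->
  restricted_edge_cut 3 (boundary A).
Proof.
move=> A0 cA0 sA; apply: boundary_restricted => // x.
have [y [z [axy zx zy az [xyA xzA]]]] := sA x; exists [set x; y; z].
  rewrite setUC cardsU1 cards2 !inE negb_or zx zy /=.
  by case: eqVneq axy => // ->; rewrite adj_irrefl.
have cxy : connect (delete_adj (boundary A)) x y.
  by apply: connect1; rewrite delete_boundary axy xyA eqxx.
move=> t; rewrite !inE => /orP[/orP[]|]/eqP -> //.
case/orP: az => [axz|ayz].
  by apply: connect1; rewrite delete_boundary axz xzA eqxx.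
by apply: connect_trans cxy _; apply: connect1; rewrite delete_boundary ayz -xyA xzA eqxx.
Qed.

(** Any vertex has at most three neighbours in the triple, hence at least two outside it as
    [d >= 5]; an outside vertex thus lies on a path of three outside vertices. *)
Lemma triple_restricted d p q r : regular d X -> 5 <= d ->
  p != r -> adj p q -> adj q r ->
  restricted_edge_cut 3 (boundary [set p; q; r]).
Proof.
move=> Xreg d5 pr pq qr; set A := [set p; q; r].
have npq : p != q by apply: contraTneq pq => ->; rewrite adj_irrefl.
have nqr : q != r by apply: contraTneq qr => ->; rewrite adj_irrefl.
have A3 : #|A| = 3.
  by rewrite /A setUC cardsU1 cards2 npq !inE negb_or eq_sym pr eq_sym nqr.
have pA : p \in A by rewrite !inE eqxx.
have qA : q \in A by rewrite !inE eqxx orbT.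
have rA : r \in A by rewrite !inE eqxx !orbT.
have deg x : 1 < degree_in (~: A) x.
  have := degree_inC A x Xreg; rewrite {1}degree_inE.
  have : #|[set y in A | adj x y]| <= #|A|.
    by apply/subset_leq_card/subsetP => y; rewrite inE => /andP[].
  by lia.
apply: same_side_restricted3.
- by apply/set0Pn; exists p.
- have := ltnW (deg p); rewrite degree_inE card_gt0 => /set0Pn[x].
  by rewrite inE => /andP[xA _]; apply/set0Pn; exists x.
move=> x; case: (boolP (x \in A)) => [|xA].
  rewrite !inE => /orP[/orP[]|]/eqP ->.
  - by exists q, r; rewrite pq qr qA rA orbT eq_sym pr eq_sym nqr.
  - by exists p, r; rewrite adj_sym pq qr pA rA eq_sym nqr eq_sym pr.
  - by exists q, p; rewrite adj_sym qr (adj_sym q) pq pA qA orbT pr npq.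
have := deg x; rewrite degree_inE => /card_gt1P[y [z [+ + yz]]].
rewrite in_set in_setC => /andP[yA xy]; rewrite in_set in_setC => /andP[zA xz].
exists y, z; rewrite xy xz (negPf yA) (negPf zA) (eq_sym z y) yz; split=> //.
by apply: contraTneq xz => ->; rewrite adj_irrefl.
Qed.

Lemma restricted_edge_connectivityP j :
  restricted_edge_connectivity j X = +oo%E \/
  exists2 S : {set {set X}}, restricted_edge_cut j S &
    restricted_edge_connectivity j X = (#|S|%:Z)%:E.
Proof.
case: (pickP (@restricted_edge_cut j X)) => [S Scut|nocut]; last first.
  by left; rewrite /restricted_edge_connectivity big_pred0.
have [|T Tcut TE] := @eq_bigmin _ _ _ +oo%E _ _ 
  (fun T : {set {set X}} => #|T|%:Z%:E) Scut.
  by move=> T _; exact: leey.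
by right; exists T.
Qed.

End RestrictedCuts.

(** * Lifting cuts of the factor to the product *)

Section Cylinders.
Variables (G : sgraph) (n : nat).
Local Notation X := (direct_product G (complete n)).

Definition cylinder (B : {set G}) : {set X} := [set p : X | p.1 \in B].

Lemma sum_complete_adj : \sum_(i < n) \sum_(j < n) complete_adj i j = n * (n - 1).
Proof.
have row (i : 'I_n) : \sum_(j < n) complete_adj i j = n - 1.
  rewrite -big_mkcond /= sum1_card subn1 -[in RHS](card_ord n) -(cardsC1 i).
  by apply: eq_card => j; rewrite !inE eq_sym.
by under eq_bigr do rewrite row; rewrite sum_nat_const card_ord.
Qed.

(** Each cut edge of [G] lifts to a whole crown graph, which has [n(n - 1)] edges. *)
Lemma cut_cylinder B : cut_size (cylinder B) = n * (n - 1) * cut_size B.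
Proof.
apply: double_inj; rewrite cut_product [RHS]doubleMr cut_size_double big_distrr /=.
apply: eq_bigr => u _; rewrite big_distrr /=; apply: eq_bigr => v _.
rewrite mulnCA; congr (_ * _); rewrite -sum_complete_adj /crown_cut big_distrl /=.
apply: eq_bigr => i _; rewrite big_distrl /=; apply: eq_bigr => j _.
by rewrite !inE.
Qed.

(** An edge [uv] on one side lifts to a path [(u, i)], [(v, j)], [(u, l)] with distinct [i], [j],
    [l]; thus two vertices per component become three. *)
Lemma cylinder_restricted B : 3 <= n ->
  B != set0 -> ~: B != set0 -> same_side_neighbors B ->
  restricted_edge_cut 3 (boundary (cylinder B)).
Proof.
move=> n3 /set0Pn[b bB] /set0Pn[c cB] sB; have n0 : 0 < n by lia.
apply: same_side_restricted3.
- by apply/set0Pn; exists (b, Ordinal n0); rewrite inE.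
- by apply/set0Pn; exists (c, Ordinal n0); rewrite !inE; rewrite inE in cB.
move=> [u i]; have [v uv uvB] := sB u.
have : 1 < #|[set~ i]| by rewrite cardsC1 card_ord; lia.
move=> /card_gt1P[j [l []]]; rewrite !inE => ji li jl.
exists (v, j), (u, l); rewrite /= /direct_adj /= /complete_adj !inE /= uv.
rewrite !xpair_eqE (adj_sym v) uv eqxx (eq_sym i) ji jl li orbT /=.
by split => //; rewrite (eq_sym l) (negPf jl) andbF.
Qed.
End Cylinders.

(** * The formula with a common parameter for both girth cases *)

Section Main.
Variables (G : sgraph) (k n e : nat).
Hypotheses (Greg : regular k G) (k_ge2 : 2 <= k) (n_ge5 : 5 <= n).
Local Notation X := (direct_product G (complete n)).
(** [e] bounds the ordered adjacent pairs among three vertices, in [G] and in the product; [triple]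
    attains it along a path of the product. *)
Hypotheses (e_ge4 : 4 <= e)
  (eG : forall B : {set G}, #|B| = 3 -> inner_pairs B <= e)
  (eX : forall B : {set X}, #|B| = 3 -> inner_pairs B <= e)
  (triple : exists p q r : X, [/\ p != r, adj p q, adj q r
                                & e <= inner_pairs [set p; q; r]]).

Lemma restricted_cut_lower (S : {set {set X}}) : restricted_edge_cut 3 S ->
  3 * k * (n - 1) <= #|S| + e \/
  exists2 S2 : {set {set G}},
    restricted_edge_cut 2 S2 & n * (n - 1) * #|S2| <= #|S|.
Proof.
case/(@restricted_cut_side _ 3 _ isT) => A [A3 cA3 sA cutS].
have no_full (C : {set X}) : same_side_neighbors C -> 3 <= #|C| ->
    cut_size C = cut_size A -> (forall u, #|fibre C u| < n) ->
    3 * k * (n - 1) <= #|S| + e.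
  move=> sC C3 cutC fC; apply: leq_trans (_ : cut_size C + e <= _); last by lia.
  apply: (cut_ge_no_full Greg) => //.
  have /card_gt0P[p pC] : 0 < #|C| by lia.
  by have [q pq] := sC p; rewrite pC => qC; exists p, q.
case: (pickP (fun u => #|fibre A u| == n)) => [u /eqP fu|nofull]; last first.
  left; apply: (no_full A) => // u.
  by have := nofull u; have := card_fibre_le A u; lia.
case: (pickP (fun u => #|fibre A u| == 0)) => [v /eqP fv|noempty]; last first.
  left; apply: (no_full (~: A)) => // [|| w]; first exact: same_side_neighborsC.
    exact: cut_sizeC.
  by have := noempty w; rewrite card_fibreC; have := card_fibre_le A w; lia.
have uv : u != v by apply/eqP => uv; rewrite uv fv in fu; lia.
pose proper_cut (B : {set G}) := (B != set0) && (~: B != set0).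
have puv : proper_cut [set u].
  apply/andP; split; apply/set0Pn; first by exists u; rewrite set11.
  by exists v; rewrite !inE eq_sym.
(* With both a full and an empty fibre, the coarea bound is applied to a minimum edge cut [B] of
   [G]. *)
case: (arg_minnP (fun B => cut_size B) puv) => B /andP[B0 cB0] minB.
have cutA : n * (n - 1) * cut_size B <= #|S|.
  apply: leq_trans cutS; apply: (@cut_ge_levels _ _ _ u v) => //; first by lia.
  by move=> C C0 cC0; apply: minB; apply/andP.
case: (cut_size_ge_degree B Greg) => [sB|kB].
  by right; exists (boundary B); [exact: same_side_restricted|rewrite card_boundary].
(* Otherwise [B] cuts at least [k] edges, and [n >= 5] exceeds the factor 3. *)
left; have : 5 * (n - 1) * k <= n * (n - 1) * cut_size B.
  by apply: leq_mul => //; rewrite leq_mul2r n_ge5 orbT.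
by have := leq0n ((n - 1) * k); lia.
Qed.

Lemma restricted_edge_connectivity_product :
  restricted_edge_connectivity 3 X =
  mine ((n%:Z * (n%:Z - 1))%R%:E * restricted_edge_connectivity 2 G)%E
       (3 * k%:Z * (n%:Z - 1) - e%:Z)%R%:E.
Proof.
(* Positivity keeps the product equal to [+oo] when [G] has no 2-restricted cut, and allows
   cancelling the factor. *)
have nn_gt0 : (0 < (n%:Z * (n%:Z - 1))%R%:E)%E by rewrite lte_fin; nia.
have nnE (c : nat) :
    ((n%:Z * (n%:Z - 1))%R%:E * c%:Z%:E = (n * (n - 1) * c)%N%:Z%:E)%E.
  by rewrite -EFinM; congr (_%:E); lia.
apply/le_anti/andP; split.
  rewrite le_min; apply/andP; split.
    case: (restricted_edge_connectivityP G 2) => [->|[S2 S2cut ->]].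
      by rewrite gt0_muley // leey.
    (* An optimal cut of [G] is replaced by the boundary of one side, whose cylinder is a competitor
       in the product. *)
    have [B [B2 cB2 sB cutB]] := @restricted_cut_side _ 2 _ isT S2cut.
    rewrite nnE; apply: bigmin_inf (@cylinder_restricted G n B _ _ _ sB) _.
    - by lia.
    - by rewrite -card_gt0; lia.
    - by rewrite -card_gt0; lia.
    - by rewrite lee_fin card_boundary cut_cylinder lez_nat leq_mul2l cutB orbT.
  have [p [q [r [pr pq qr eA]]]] := triple.
  have Xreg := @regular_product G k n Greg.
  have d5 : 5 <= k * (n - 1) by nia.
  apply: bigmin_inf (triple_restricted Xreg d5 pr pq qr) _.
  rewrite lee_fin card_boundary.
  have := cut_inner [set p; q; r] Xreg.
  have : #|[set p; q; r]| <= 3.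
    by rewrite setUC cardsU1 cards2; case: (p != q); case: (r \notin _).
  move: eA; move: #|_| (cut_size _) (inner_pairs _) => c a b eb c3 abE.
  have : k * (n - 1) * c <= k * (n - 1) * 3 by rewrite leq_mul2l c3 orbT.
  rewrite -abE; have [m ->] : exists m, n = m + 1 by exists (n - 1); lia.
  lia.
apply: le_bigmin => [|S Scut]; first exact: leey.
rewrite ge_min; case: (restricted_cut_lower Scut) => [h|[S2 S2cut h]].
  apply/orP; right; rewrite lee_fin; nia.
apply/orP; left; apply: (@le_trans _ _ (n * (n - 1) * #|S2|)%N%:Z%:E).
  by rewrite -nnE lee_pmul2l //; exact: bigmin_le_cond.
by rewrite lee_fin lez_nat.
Qed.

End Main.

(** * The two girth cases *)

(** The first projection is a homomorphism, so it maps triangles to triangles. *)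
Lemma direct_triangle_free (G H : sgraph) :
  (forall x y z : G, ~~ [&& adj x y, adj y z & adj z x]) ->
  forall p q r : direct_product G H, ~~ [&& adj p q, adj q r & adj r p].
Proof.
move=> notri p q r; apply: contra (notri p.1 q.1 r.1).
by case/and3P => /andP[-> _] /andP[-> _] /andP[-> _].
Qed.

Theorem theorem3p2 (G : sgraph) (k n : nat)
    (Gconn : connected G) (Greg : regular k G)
    (k_ge2 : (2 <= k)%N) (G_ge4 : (4 <= #|G|)%N) (n_ge5 : (5 <= n)%N) :
  (girth G = 3%:E ->
    restricted_edge_connectivity 3 (direct_product G (complete n)) =
      mine ((n%:Z * (n%:Z - 1))%R%:E * restricted_edge_connectivity 2 G)%E
           (3 * k%:Z * (n%:Z - 1) - 6)%R%:E) /\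
  ((4%:E <= girth G)%E ->
    restricted_edge_connectivity 3 (direct_product G (complete n)) =
      mine ((n%:Z * (n%:Z - 1))%R%:E * restricted_edge_connectivity 2 G)%E
           (3 * k%:Z * (n%:Z - 1) - 4)%R%:E).
Proof.
have n0 : 0 < n by lia.
have n1 : 1 < n by lia.
have n2 : 2 < n by lia.
pose i0 := Ordinal n0; pose i1 := Ordinal n1; pose i2 := Ordinal n2.
split=> girthG.
  have /has_cycle3P[x [y [z /and3P[xy yz zx]]]] : has_cycle G 3.
    (* Without a 3-cycle every cycle length is at least 4, and so is the default [+oo]. *)
    apply: contraTT isT => no3; have : (4%:E <= girth G)%E.
      apply: le_bigmin => [|l lcyc]; first exact: leey.
      rewrite lee_fin lez_nat; case: (ltngtP l 3) => // l3.
        by move: lcyc; rewrite /has_cycle ltnNge -ltnS l3.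
      by rewrite l3 (negPf no3) in lcyc.
    by rewrite girthG.
  apply: (@restricted_edge_connectivity_product G k n 6) => //.
  - exact: inner_pairs3_le6.
  - exact: inner_pairs3_le6.
  (* Distinct second coordinates lift the triangle to one in the product, with 6 ordered pairs. *)
  exists (x, i0), (y, i1), (z, i2).
  have pq : adj ((x, i0) : direct_product G (complete n)) (y, i1)
    by rewrite /= /direct_adj /= xy.
  have qr : adj ((y, i1) : direct_product G (complete n)) (z, i2)
    by rewrite /= /direct_adj /= yz.
  have rp : adj ((z, i2) : direct_product G (complete n)) (x, i0)
    by rewrite /= /direct_adj /= zx.
  by rewrite inner_pairs3 ?pq ?qr ?rp // xpair_eqE andbF.
have notri (x y z : G) : ~~ [&& adj x y, adj y z & adj z x].
  apply: contraTN girthG => xyz; rewrite -ltNge.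
  apply: (@le_lt_trans _ _ 3%:E) => //.
  (* The length 3 is in the index range of [girth]. *)
  have l3 : 3 < #|G|.+1 by lia.
  by apply: (bigmin_inf (Ordinal l3)) => //; apply/has_cycle3P; exists x, y, z.
apply: (@restricted_edge_connectivity_product G k n 4) => //.
- by move=> B; apply: inner_pairs3_le4.
- by move=> B; apply/inner_pairs3_le4/direct_triangle_free.
(* As [k >= 2], some vertex [x] has two neighbours; the path through it lifts to one with 4 ordered
   pairs. *)
have /card_gt0P[x _] : 0 < #|G| by lia.
have : 1 < #|neighbors x| by rewrite Greg.
move=> /card_gt1P[y [z []]]; rewrite !inE => xy xz yz.
exists (y, i0), (x, i1), (z, i2).
have pq : adj ((y, i0) : direct_product G (complete n)) (x, i1).
  by rewrite /= /direct_adj /= adj_sym xy.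
have qr : adj ((x, i1) : direct_product G (complete n)) (z, i2)
    by rewrite /= /direct_adj /= xz.
by rewrite inner_pairs3 ?pq ?qr ?xpair_eqE ?andbF //; split => //; lia.
Qed.
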